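(* Consider an unregularized MDP and run PMD with Bregman distance the squared Euclidean distance, i.e. $D^{\pi'}_{\pi}(s)=\tfrac12\|\pi'(\cdot\mid s)-\pi(\cdot\mid s)\|_2^2$. Let $N:=\lceil 4(1-\gamma)^{-1}\rceil$, $T:=\lceil\log_2(|\mathcal S|^3|\mathcal A|/(1-\gamma)^2)\rceil+1$, and use the step sizes $$\eta_t=\frac{2^{t+1}}{\Delta_{NT\lfloor t/(NT)\rfloor}},\qquad \Delta_{j}:=(1-\gamma)^{-1}\max_{s\in\mathcal S}g^{\pi_{j}}(s).$$ Then for any iteration $\tau\ge|\mathcal S|(|\mathcal A|-1)NT$, the greedy policy is optimal: $\hat\pi_\tau=\pi^*$.
   Context: An unregularized infinite-horizon discounted MDP ($h\equiv0$): finite $\mathcal S$, $\mathcal A$, transition probabilities $\mathcal P(s'\mid s,a)$, cost $c$, discount $\gamma\in[0,1)$. A policy assigns $\pi(\cdot\mid s)\in\Delta_{|\mathcal A|}$. $V^\pi(s)=\mathbb E[\sum_{t\ge0}\gamma^tc(s_t,a_t)\mid s_0=s,\ a_t\sim\pi(\cdot\mid s_t),\ s_{t+1}\sim\mathcal P(\cdot\mid s_t,a_t)]$, $Q^\pi(s,a)$ the same with $a_0=a$. Advantage $\psi^\pi(s,p):=\langle Q^\pi(s,\cdot),p\rangle-V^\pi(s)$; gap $g^\pi(s):=\max_{p\in\Delta_{|\mathcal A|}}\{-\psi^\pi(s,p)\}$. $\pi^*$ is the optimal policy ($V^{\pi^*}\le V^\pi$ pointwise for all $\pi$). PMD with this distance: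 $\pi_{t+1}(\cdot\mid s)=\operatorname{argmin}_{p\in\Delta_{|\mathcal A|}}\{\eta_t\langle Q^{\pi_t}(s,\cdot),p\rangle+\tfrac12\|p-\pi_t(\cdot\mid s)\|_2^2\}$ for all $s$, from an initial policy $\pi_0$. The greedy policy $\hat\pi_\tau$ of $\pi_\tau$ is given by $\hat\pi_\tau(\cdot\mid s)\in\operatorname{argmin}_{p\in\Delta_{|\mathcal A|}}\psi^{\pi_\tau}(s,p)$, chosen to be a vertex of the simplex, ties broken arbitrarily. *)

(* Defs.v *)
From mathcomp Require Import all_boot all_order all_algebra.
From mathcomp Require Import all_classical all_reals all_analysis.
Set Implicit Arguments. Unset Strict Implicit. Unset Printing Implicit Defensive.
Import Order.TTheory GRing.Theory Num.Theory.
Local Open Scope ring_scope.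

Section MDP.
Variables (R : realType) (S A : finType).
Variables (P : S -> A -> S -> R) (c : S -> A -> R) (gamma : R).

Definition in_simplex (p : A -> R) : Prop :=
  (forall a, 0 <= p a) /\ \sum_(a : A) p a = 1.

Definition is_policy (pi : S -> A -> R) : Prop := forall s, in_simplex (pi s).

Definition cost_pi (pi : S -> A -> R) (s : S) : R := \sum_(a : A) pi s a * c s a.
Definition trans_pi (pi : S -> A -> R) (f : S -> R) (s : S) : R :=
  \sum_(a : A) pi s a * \sum_(s' : S) P s a s' * f s'.

(* E[c(s_t,a_t) | s_0 = s] under pi, i.e. (P_pi^t c_pi)(s) *)
Definition exp_cost_t (pi : S -> A -> R) (t : nat) : S -> R :=
  iter t (trans_pi pi) (cost_pi pi).

Definition Vpi (pi : S -> A -> R) (s : S) : R :=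
  limn (fun n => \sum_(0 <= t < n) gamma ^+ t * exp_cost_t pi t s).

Definition exp_cost_t_a (pi : S -> A -> R) (s : S) (a : A) (t : nat) : R :=
  match t with
  | 0 => c s a
  | t'.+1 => \sum_(s' : S) P s a s' * exp_cost_t pi t' s'
  end.
Definition Qpi (pi : S -> A -> R) (s : S) (a : A) : R :=
  limn (fun n => \sum_(0 <= t < n) gamma ^+ t * exp_cost_t_a pi s a t).

Definition psi (pi : S -> A -> R) (s : S) (p : A -> R) : R :=
  \sum_(a : A) Qpi pi s a * p a - Vpi pi s.

Definition gap (pi : S -> A -> R) (s : S) : R :=
  sup [set - psi pi s p | p in in_simplex].

Definition Delta (pi : S -> A -> R) : R :=
  (1 - gamma)^-1 * sup [set gap pi s | s in [set: S]].

Definition pmd_obj (eta : R) (pi : S -> A -> R) (s : S) (p : A -> R) : R :=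
  eta * \sum_(a : A) Qpi pi s a * p a
  + 2^-1 * \sum_(a : A) (p a - pi s a) ^+ 2.

Definition N_const : nat := `|Num.ceil (4 / (1 - gamma))|%N.
Definition T_const : nat :=
  (`|Num.ceil (ln ((#|S| ^ 3 * #|A|)%:R / (1 - gamma) ^+ 2) / ln 2)|.+1)%N.

Definition eta_step (pis : nat -> S -> A -> R) (t : nat) : R :=
  2 ^+ t.+1 / Delta (pis ((t %/ (N_const * T_const)) * (N_const * T_const))%N).

Definition is_pmd_run (pis : nat -> S -> A -> R) : Prop :=
  is_policy (pis 0%N) /\
  forall t s, in_simplex (pis t.+1 s) /\
    forall p, in_simplex p ->
      pmd_obj (eta_step pis t) (pis t) s (pis t.+1 s)
      <= pmd_obj (eta_step pis t) (pis t) s p.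

Definition is_greedy (pi hpi : S -> A -> R) : Prop :=
  forall s, (exists a0 : A, forall a, hpi s a = (a == a0)%:R) /\
    forall p, in_simplex p -> psi pi s (hpi s) <= psi pi s p.

Definition is_optimal (pistar : S -> A -> R) : Prop :=
  is_policy pistar /\
  forall pi, is_policy pi -> forall s, Vpi pistar s <= Vpi pi s.

End MDP.

Definition is_transition (R : realType) (S A : finType) (P : S -> A -> S -> R) :=
  forall s a, (forall s', 0 <= P s a s') /\ \sum_(s' : S) P s a s' = 1.

(* Main.v *)
Require Import Defs.
From mathcomp Require Import all_boot all_order all_algebra.
From mathcomp Require Import all_classical all_reals all_analysis.
From mathcomp Require Import zify ring lra.
Import Order.TTheory GRing.Theory Num.Theory.
Import numFieldNormedType.Exports.
Local Open Scope ring_scope.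

Set Implicit Arguments.
Unset Strict Implicit.

(* Fix a deterministic policy pistar minimizing the sum of the values; its
   advantages adv = Q^{pistar} - V^{pistar} are nonnegative, so it is optimal.  Put
   M_t = max_s (V^{pi_t} - V^{pistar}) and L = N T.  Comparing pi_{t+1} with pistar in
   the proximal step gives M_{t+1} <= gamma M_t + 1 / eta_t, so by the end of an
   epoch starting at j the error M has dropped to at most (1 - gamma) M_j / 2.
   On the other hand, as long as M_j > 0, the policy pi_j puts positive mass on
   some action with adv >= (1 - gamma) M_j.  From the end of that epoch on, this
   action is so much worse than the average, relative to 1 / eta_t, that the
   Euclidean projection gives it probability exactly 0, and it can no longer be
   greedy.  Hence distinct epochs eliminate distinct suboptimal actions, of which
   there are at most |S| (|A| - 1). *)

(** * Averages over the probability simplex *)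

Section Averages.
Variables (R : realType) (I : finType).
Implicit Types (p q f g : I -> R).

Lemma avg_const p b : in_simplex p -> \sum_i p i * b = b.
Proof. by case=> _ p1; rewrite -mulr_suml p1 mul1r. Qed.

Lemma ler_avg p f g : in_simplex p -> (forall i, f i <= g i) ->
  \sum_i p i * f i <= \sum_i p i * g i.
Proof. by case=> p0 _ fg; apply: ler_sum => i _; rewrite ler_wpM2l. Qed.

Lemma norm_avg_le p f b : in_simplex p -> (forall i, `|f i| <= b) ->
  `|\sum_i p i * f i| <= b.
Proof.
move=> hp fb; apply: le_trans (ler_norm_sum _ _ _) _.
rewrite -[leRHS](avg_const b hp) ler_sum // => i _.
by rewrite normrM ger0_norm ?hp.1// ler_wpM2l ?hp.1.
Qed.

(** If all indices of positive weight had values below the mean m, the nonnegative terms p_i (m -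
    f_i), which sum to 0, would force p = 0. Elimination later contradicts the positive mass
    obtained here. *)
Lemma exists_ge_avg p f : in_simplex p ->
  exists i, 0 < p i /\ \sum_j p j * f j <= f i.
Proof.
move=> hp; set m := \sum_j p j * f j; apply: contrapT => none.
have lt_m i : 0 < p i -> f i < m.
  by move=> pi0; rewrite ltNge; apply/negP => mf; apply: none; exists i.
have ge0 i : true -> 0 <= p i * (m - f i).
  move=> _; have := hp.1 i; rewrite le_eqVlt => /orP[/eqP <-|pi0].
    by rewrite mul0r.
  by rewrite mulr_ge0 ?hp.1// subr_ge0 ltW// lt_m.
have sum0 : \sum_i p i * (m - f i) = 0.
  under eq_bigr do rewrite mulrBr.
  by rewrite sumrB avg_const// subrr.
have p0 i : p i = 0.
  apply/eqP; rewrite eq_le hp.1 andbT leNgt; apply/negP => pi0.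
  have /eqP := psumr_eq0P ge0 sum0 (i := i) isT.
  by rewrite mulf_eq0 gt_eqF//= subr_eq0 gt_eqF// lt_m.
by have := hp.2; rewrite big1// => /eqP; rewrite eq_sym oner_eq0.
Qed.

Lemma exists_le_avg p f : in_simplex p ->
  exists i, 0 < p i /\ f i <= \sum_j p j * f j.
Proof.
move=> hp; have [i [pi0]] := exists_ge_avg (fun i => - f i) hp.
under eq_bigr do rewrite mulrN.
by rewrite sumrN lerN2; exists i.
Qed.

Lemma simplex_le1 p i : in_simplex p -> p i <= 1.
Proof.
move=> hp; rewrite -hp.2 (bigD1 i)//= lerDl sumr_ge0// => j _.
exact: hp.1.
Qed.

Lemma simplex_pair_le1 p i j : in_simplex p -> i != j -> p i + p j <= 1.
Proof.
move=> hp ij; rewrite -hp.2 (bigD1 i)//= (bigD1 j) 1?eq_sym//= addrA lerDl.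
by rewrite sumr_ge0// => k _; exact: hp.1.
Qed.

(** On [0, 1] one has (x - y)^2 <= x + y, and the two masses add up to 2. *)
Lemma sqr_dist_simplex_le p q : in_simplex p -> in_simplex q ->
  2^-1 * \sum_i (p i - q i) ^+ 2 <= 1.
Proof.
move=> hp hq; suff: \sum_i (p i - q i) ^+ 2 <= \sum_i (p i + q i).
  by rewrite big_split/= hp.2 hq.2; lra.
apply: ler_sum => i _.
have := simplex_le1 i hp; have := simplex_le1 i hq.
have := hp.1 i; have := hq.1 i; nra.
Qed.

Lemma simplex_vertex i : in_simplex (fun j : I => (j == i)%:R : R).
Proof.
split=> [j|]; first exact: ler0n.
by rewrite (bigD1 i)//= eqxx big1 ?addr0// => j /negPf ->.
Qed.

Lemma avg_vertex i f : \sum_j (j == i)%:R * f j = f i.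
Proof.
rewrite (bigD1 i)//= eqxx mul1r big1 ?addr0// => j /negPf ->.
by rewrite mul0r.
Qed.

Lemma cvg_sum_fin (u : I -> nat -> R) (l : I -> R) :
  (forall i, (u i n @[n --> \oo] --> l i)%classic) ->
  ((\sum_i u i n) @[n --> \oo] --> \sum_i l i)%classic.
Proof.
move=> ul; elim: (index_enum I) => [|i r IHr].
  by under eq_fun do rewrite big_nil; rewrite big_nil; exact: cvg_cst.
under eq_fun do rewrite big_cons; rewrite big_cons; exact: cvgD.
Qed.

End Averages.

(** * Bellman equations, comparison of policies, and an optimal policy *)

Section DiscountedMDP.
Variables (R : realType) (S A : finType).
Variables (P : S -> A -> S -> R) (c : S -> A -> R) (gamma : R).
Hypothesis hP : is_transition P.
Hypotheses (hg0 : 0 <= gamma) (hg1 : gamma < 1).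
Implicit Types (pi rho : S -> A -> R) (f v : S -> R) (s : S) (a : A).

Local Notation V := (Vpi P c gamma).
Local Notation Q := (Qpi P c gamma).
Local Notation psi := (psi P c gamma).

Lemma transition_simplex s a : in_simplex (P s a).
Proof. exact: hP. Qed.

Lemma trans_pi_le pi f b s : is_policy pi -> (forall s', f s' <= b) ->
  trans_pi P pi f s <= b.
Proof.
move=> hpi fb; rewrite -[leRHS](avg_const b (hpi s)).
apply: ler_avg => // a; rewrite -[leRHS](avg_const b (transition_simplex s a)).
exact: ler_avg (transition_simplex s a) fb.
Qed.

Lemma norm_trans_pi_le pi f b s : is_policy pi -> (forall s', `|f s'| <= b) ->
  `|trans_pi P pi f s| <= b.
Proof.
move=> hpi fb; apply: norm_avg_le => // a.
exact: norm_avg_le (transition_simplex s a) fb.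
Qed.

Lemma norm_exp_cost_t_a_le pi b s a t : is_policy pi ->
  (forall s a, `|c s a| <= b) -> `|exp_cost_t_a P c pi s a t| <= b.
Proof.
move=> hpi cb; case: t => [|t]; first exact: cb.
apply: norm_avg_le (transition_simplex s a) _.
elim: t => [|t IHt] s'; last exact: norm_trans_pi_le.
exact: norm_avg_le (hpi s') (cb s').
Qed.

(** [limn] is informative only under convergence; the terms are dominated by b gamma^n, with b the
    largest absolute cost. *)
Lemma cvg_Q pi s a : is_policy pi ->
  (\sum_(0 <= t < n) gamma ^+ t * exp_cost_t_a P c pi s a t
     @[n --> \oo] --> Q pi s a)%classic.
Proof.
move=> hpi; pose b := \big[Order.max/0]_(sa : S * A) `|c sa.1 sa.2|.
have cb s' a' : `|c s' a'| <= b.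
  exact: (le_bigmax _ (fun sa : S * A => `|c sa.1 sa.2|) (s', a')).
have b0 : 0 <= b by exact: le_trans (cb s a).
suff : cvgn (series (fun t => gamma ^+ t * exp_cost_t_a P c pi s a t)) by [].
apply: normed_cvg; apply: (@series_le_cvg _ _ (geometric b gamma)).
- by move=> n /=.
- by move=> n; rewrite /geometric/= mulr_ge0// exprn_ge0.
- move=> n; rewrite /= normrM ger0_norm ?exprn_ge0// [leRHS]mulrC.
  by rewrite ler_wpM2l ?exprn_ge0// norm_exp_cost_t_a_le.
by apply: is_cvg_geometric_series; rewrite ger0_norm.
Qed.

Lemma exp_cost_tE pi t s :
  exp_cost_t P c pi t s = \sum_a pi s a * exp_cost_t_a P c pi s a t.
Proof. by case: t. Qed.

Lemma cvg_V pi s : is_policy pi ->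
  (\sum_(0 <= t < n) gamma ^+ t * exp_cost_t P c pi t s
     @[n --> \oo] --> \sum_a pi s a * Q pi s a)%classic.
Proof.
move=> hpi; have -> : (fun n =>
    \sum_(0 <= t < n) gamma ^+ t * exp_cost_t P c pi t s) = (fun n => \sum_a
    pi s a * \sum_(0 <= t < n) gamma ^+ t * exp_cost_t_a P c pi s a t).
  apply/funext => n; under [RHS]eq_bigr do rewrite mulr_sumr.
  rewrite exchange_big/=; apply: eq_bigr => t _.
  by rewrite exp_cost_tE mulr_sumr; apply: eq_bigr => a _; rewrite mulrCA.
by apply: cvg_sum_fin => a; apply: cvgMl_tmp; exact: cvg_Q.
Qed.

Lemma V_avg_Q pi s : is_policy pi -> V pi s = \sum_a pi s a * Q pi s a.
Proof. by move=> hpi; apply: cvg_lim => //; exact: cvg_V. Qed.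

Lemma QE pi s a : is_policy pi ->
  Q pi s a = c s a + gamma * \sum_s' P s a s' * V pi s'.
Proof.
(* Shifting the index splits off the cost at time 0; what remains is gamma times the averaged
   partial sums of V. *)
move=> hpi; apply: cvg_lim => //; rewrite -cvg_shiftS /=.
under eq_fun => n.
  rewrite big_nat_recl// expr0 mul1r.
  have -> : \sum_(0 <= i < n) gamma ^+ i.+1 * exp_cost_t_a P c pi s a i.+1 =
      gamma * \sum_s' P s a s' *
        \sum_(0 <= i < n) gamma ^+ i * exp_cost_t P c pi i s'.
    rewrite mulr_sumr; under [RHS]eq_bigr do rewrite 2!mulr_sumr.
    rewrite exchange_big/=; apply: eq_bigr => t _; rewrite mulr_sumr.
    by apply: eq_bigr => s' _; rewrite exprS; ring.
  over.
apply: cvgD; first exact: cvg_cst.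
apply: cvgMl_tmp; apply: cvg_sum_fin => s'; apply: cvgMl_tmp.
by rewrite V_avg_Q//; exact: cvg_V.
Qed.

Lemma psiE pi s p : psi pi s p = \sum_a p a * Q pi s a - V pi s.
Proof. by congr (_ - _); apply: eq_bigr => a _; rewrite mulrC. Qed.

Lemma psi_avg pi s p : in_simplex p ->
  psi pi s p = \sum_a p a * (Q pi s a - V pi s).
Proof.
move=> hp; rewrite psiE -[X in _ - X](avg_const _ hp) -sumrB.
by apply: eq_bigr => a _; rewrite mulrBr.
Qed.

Lemma psi_self pi s : is_policy pi -> psi pi s (pi s) = 0.
Proof. by move=> hpi; rewrite psiE -V_avg_Q// subrr. Qed.

Lemma trans_piB pi f v s :
  trans_pi P pi (fun s' => f s' - v s') s = trans_pi P pi f s - trans_pi P pi v s.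
Proof.
rewrite -sumrB; apply: eq_bigr => a _; rewrite -mulrBr -sumrB.
by congr (_ * _); apply: eq_bigr => s' _; rewrite mulrBr.
Qed.

(** The performance difference lemma, kept as a one-step recursion so that the maximum principle
    applies to it. *)
Lemma V_sub pi rho s : is_policy pi -> is_policy rho ->
  V rho s - V pi s =
  psi pi s (rho s) + gamma * trans_pi P rho (fun s' => V rho s' - V pi s') s.
Proof.
move=> hpi hrho.
have avgE pi' : is_policy pi' -> \sum_a rho s a * Q pi' s a =
    \sum_a rho s a * c s a + gamma * trans_pi P rho (V pi') s.
  move=> hpi'; rewrite mulr_sumr -big_split; apply: eq_bigr => a _.
  by rewrite /= QE//; ring.
by rewrite psiE trans_piB (V_avg_Q _ hrho) !avgE//; ring.
Qed.

(* Evaluate the hypothesis at a maximizer of f. *)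
Lemma discounted_max_principle pi f b : is_policy pi ->
  (forall s, f s <= gamma * trans_pi P pi f s + b) ->
  forall s, f s <= b / (1 - gamma).
Proof.
move=> hpi fb s; have g1 : 0 < 1 - gamma by rewrite subr_gt0.
have [m _ fm] := arg_maxP f (i0 := s) (P := xpredT) isT.
apply: le_trans (fm s isT) _; rewrite ler_pdivlMr// mulrBr mulr1 lerBlDr addrC.
apply: le_trans (fb m) _; rewrite lerD2r mulrC ler_wpM2r//.
by apply: trans_pi_le => // s'; exact: fm.
Qed.

(** Policy improvement: the maximum principle with b = 0 gives V^rho <= V^pi, so the discounted term
    of [V_sub] is nonpositive. *)
Lemma V_sub_le_psi pi rho : is_policy pi -> is_policy rho ->
  (forall s, psi pi s (rho s) <= 0) ->
  forall s, V rho s - V pi s <= psi pi s (rho s).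
Proof.
move=> hpi hrho psi0 s.
have le0 s' : V rho s' - V pi s' <= 0.
  rewrite -(mul0r (1 - gamma)^-1); move: s'.
  apply: (discounted_max_principle hrho) => s'.
  by rewrite V_sub// addrC lerD2l.
by rewrite V_sub// gerDl mulr_ge0_le0// trans_pi_le.
Qed.

Lemma V_le_of_adv_ge0 pi rho : is_policy pi -> is_policy rho ->
  (forall s a, 0 <= Q pi s a - V pi s) -> forall s, V pi s <= V rho s.
Proof.
move=> hpi hrho adv0 s; rewrite -subr_ge0 -oppr_le0 opprB.
rewrite -(mul0r (1 - gamma)^-1); move: s.
apply: (discounted_max_principle hrho) => s.
have := V_sub s hpi hrho; rewrite !trans_piB.
have : 0 <= psi pi s (rho s).
  by rewrite psi_avg// sumr_ge0// => a _; rewrite mulr_ge0// (hrho s).1.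
by lra.
Qed.

(* A deterministic policy minimizing the sum of its values cannot be improved
   by acting greedily at any state. *)
Lemma exists_adv_ge0 pi0 : is_policy pi0 ->
  exists2 pistar, is_policy pistar &
    forall s a, 0 <= Q pistar s a - V pistar s.
Proof.
move=> hpi0; pose det (d : {ffun S -> A}) s a : R := (a == d s)%:R.
have hdet d : is_policy (det d) by move=> s; exact: simplex_vertex.
have choose (f : S -> A -> R) : exists d : {ffun S -> A},
    forall s a, f s (d s) <= f s a.
  suff /choice[d dP] : forall s, exists a0, forall a, f s a0 <= f s a.
    by exists [ffun s => d s] => s a; rewrite ffunE.
  (* Only an inhabitant of A is wanted, to start the minimization; the simplex at s provides one. *)
  move=> s; have [a0 _] := exists_le_avg (f s) (hpi0 s).
  have [m _ fm] := arg_minP (f s) (i0 := a0) (P := xpredT) isT.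
  by exists m => a; exact: fm.
have [d0 _] := choose (fun _ _ => 0).
have [d _ dmin] := arg_minP (fun d => \sum_s V (det d) s) (i0 := d0)
  (P := xpredT) isT.
exists (det d) => // s a; have [d' d'min] := choose (Q (det d)).
have psid' s' : psi (det d) s' (det d' s') = Q (det d) s' (d' s') - V (det d) s'.
  by rewrite psiE avg_vertex.
have psi0 s' : psi (det d) s' (det d' s') <= 0.
  rewrite psid' subr_le0 (V_avg_Q _ (hdet d)).
  rewrite -[leLHS](avg_const _ (hdet d s')).
  exact: ler_avg (hdet d s') (d'min s').
have lepsi := V_sub_le_psi (hdet d) (hdet d') psi0.
(* [d'] improves on [d] at every state, while the sum of values of [d] is minimal, so no state
   improves strictly. *)
have Veq s' : V (det d) s' - V (det d') s' = 0.
  have ge0 s1 : true -> 0 <= V (det d) s1 - V (det d') s1.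
    by move=> _; rewrite subr_ge0 -subr_le0; exact: le_trans (lepsi s1) _.
  apply: (psumr_eq0P ge0) => //; apply/eqP.
  by rewrite eq_le sumr_ge0// andbT sumrB subr_le0 dmin.
apply: le_trans (_ : psi (det d) s (det d' s) <= _).
  by apply: le_trans (lepsi s); rewrite -oppr_le0 opprB Veq.
by rewrite psid' lerD2r.
Qed.

End DiscountedMDP.

(** * Moving mass between two coordinates *)

Section MassTransfer.
Variables (R : realType) (I : finType) (q : I -> R) (a a' : I).
Hypothesis aa' : a != a'.

Definition transfer (i : I) : R :=
  if i == a then 0 else if i == a' then q a' + q a else q i.

(** A general summand F covers the total mass and both the linear and the quadratic part of the
    objective. *)
Lemma sum_transferB (F : I -> R -> R) :
  \sum_i F i (transfer i) - \sum_i F i (q i) =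
  F a 0 - F a (q a) + (F a' (q a' + q a) - F a' (q a')).
Proof.
have a'a : a' != a by rewrite eq_sym.
rewrite -sumrB (bigD1 a)//= (bigD1 a')//= big1 => [|i /andP[ia ia']].
  by rewrite /transfer !eqxx (negPf a'a) addr0.
by rewrite /transfer (negPf ia) (negPf ia') subrr.
Qed.

Lemma transfer_simplex : in_simplex q -> in_simplex transfer.
Proof.
move=> [q0 q1]; split=> [i|].
  by rewrite /transfer; case: ifP => // _; case: ifP => // _; rewrite addr_ge0.
by have := sum_transferB (fun _ x => x); rewrite q1; lra.
Qed.

End MassTransfer.

(** * The proximal step *)

Section PMDStep.
Variables (R : realType) (S A : finType).
Variables (P : S -> A -> S -> R) (c : S -> A -> R) (gamma : R).
Hypothesis hP : is_transition P.
Hypotheses (hg0 : 0 <= gamma) (hg1 : gamma < 1).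

Local Notation V := (Vpi P c gamma).
Local Notation Q := (Qpi P c gamma).
Local Notation psi := (psi P c gamma).
Local Notation gap := (gap P c gamma).
Local Notation Delta := (Delta P c gamma).
Local Notation obj := (pmd_obj P c gamma).

(* Otherwise moving all the mass of a onto a' would decrease the objective. *)
Lemma pmd_argmin_eq0 eta (pi : S -> A -> R) s q a a' :
  in_simplex (pi s) -> in_simplex q ->
  (forall p, in_simplex p -> obj eta pi s q <= obj eta pi s p) ->
  2 <= eta * (Q pi s a - Q pi s a') -> q a = 0.
Proof.
move=> hpi hq qmin far.
have aa' : a != a'.
  by apply/eqP => aa'; move: far; rewrite aa' subrr mulr0; lra.
apply/eqP; rewrite eq_le hq.1 andbT leNgt; apply/negP => qa0.
have := qmin _ (transfer_simplex aa' hq); rewrite /pmd_obj.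
have := sum_transferB q aa' (fun i x => Q pi s i * x).
have := sum_transferB q aa' (fun i x => (x - pi s i) ^+ 2).
set t1 := \sum_i _; set t2 := \sum_i _; set t3 := \sum_i _; set t4 := \sum_i _.
move=> /eqP; rewrite subr_eq => /eqP ->.
move=> /eqP; rewrite subr_eq => /eqP -> le.
(* The squares of q a cancel, so this is the change of the objective. The bracket is at most -2 + 1
   + (1 - q a), which is negative. *)
have : 0 <= q a * (- (eta * (Q pi s a - Q pi s a')) + pi s a + q a' - pi s a').
  by move: le; nra.
rewrite pmulr_rge0//.
have := simplex_le1 a hpi; have := hpi.1 a'; have := simplex_pair_le1 hq aa'.
lra.
Qed.

(** * Error against a fixed optimal policy *)

Section OptimalReference.
Variable pistar : S -> A -> R.
Hypothesis hpistar : is_policy pistar.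
Hypothesis adv_ge0 : forall s a, 0 <= Q pistar s a - V pistar s.

(** The sup-norm error of V^pi when pi is a policy; the seed 0 makes it nonnegative by
    construction. *)
Definition subopt (pi : S -> A -> R) : R :=
  \big[Order.max/0]_s (V pi s - V pistar s).

Lemma subopt_ge0 pi : 0 <= subopt pi.
Proof. exact: bigmax_ge_id. Qed.

Lemma le_subopt pi s : V pi s - V pistar s <= subopt pi.
Proof. exact: le_bigmax. Qed.

Lemma subopt_le pi b : 0 <= b -> (forall s, V pi s - V pistar s <= b) ->
  subopt pi <= b.
Proof. by move=> b0 lb; apply: bigmax_le. Qed.

Lemma Vstar_le pi s : is_policy pi -> V pistar s <= V pi s.
Proof. by move=> hpi; exact: V_le_of_adv_ge0 hP hg0 hg1 _ _ hpistar hpi _ _. Qed.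

(** Passing from [pistar] to pi does not lower Q, and raises V by at most [subopt pi]. This carries
    the fixed advantages over to any iterate. *)
Lemma adv_le pi s a : is_policy pi ->
  Q pistar s a - V pistar s - subopt pi <= Q pi s a - V pi s.
Proof.
move=> hpi; have := le_subopt pi s.
suff : Q pistar s a <= Q pi s a by lra.
rewrite !QE// lerD2l ler_wpM2l//; apply: ler_avg; first exact: hP.
by move=> s'; exact: Vstar_le.
Qed.

(** This also bounds the set under the supremum in [gap], so that supremum is genuine. *)
Lemma oppr_psi_le pi s p : is_policy pi -> in_simplex p ->
  - psi pi s p <= subopt pi.
Proof.
move=> hpi hp; rewrite lerNl psi_avg//.
rewrite -[leLHS](avg_const _ hp); apply: ler_avg => // a.
by have := adv_le s a hpi; have := adv_ge0 s a; lra.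
Qed.

Lemma oppr_psi_le_gap pi s p : is_policy pi -> in_simplex p ->
  - psi pi s p <= gap pi s.
Proof.
move=> hpi hp; apply: ub_le_sup; last by exists p.
by exists (subopt pi) => _ [q hq <-]; exact: oppr_psi_le.
Qed.

Lemma gap_le_subopt pi s : is_policy pi -> gap pi s <= subopt pi.
Proof.
move=> hpi; apply: ge_sup; first by exists (- psi pi s (pi s)), (pi s).
by move=> _ [q hq <-]; exact: oppr_psi_le.
Qed.

(** Along [pistar] the error equals -psi plus its discounted average, and -psi is at most the
    largest gap. *)
Lemma V_sub_le_Delta pi s : is_policy pi -> V pi s - V pistar s <= Delta pi.
Proof.
move=> hpi; rewrite /Defs.Delta mulrC; move: s.
apply: (discounted_max_principle hP hg0 hg1 hpistar) => s.
have gap_le : gap pi s <= sup [set gap pi s | s in [set: S]]%classic.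
  apply: ub_le_sup; last by exists s.
  by exists (subopt pi) => _ [s' _ <-]; exact: gap_le_subopt.
have := V_sub c hP hg0 hg1 s hpi hpistar.
have := oppr_psi_le_gap s hpi (hpistar s).
rewrite !trans_piB; lra.
Qed.

(** Together with [V_sub_le_Delta], this makes [Delta] equal to the error up to a factor 1 / (1 -
    gamma). The state [s0] makes the set of gaps nonempty. *)
Lemma Delta_le (s0 : S) pi : is_policy pi ->
  (1 - gamma) * Delta pi <= subopt pi.
Proof.
move=> hpi; rewrite /Defs.Delta mulVKf ?subr_eq0 ?gt_eqF//.
apply: ge_sup; first by exists (gap pi s0), s0.
by move=> _ [s _ <-]; exact: gap_le_subopt.
Qed.

Lemma Delta_ge0 (s0 : S) pi : is_policy pi -> 0 <= Delta pi.
Proof.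
move=> hpi; apply: le_trans (V_sub_le_Delta s0 hpi).
by rewrite subr_ge0 Vstar_le.
Qed.

Lemma subopt_le_Delta (s0 : S) pi : is_policy pi -> subopt pi <= Delta pi.
Proof.
move=> hpi; apply: subopt_le => [|s]; first exact: (Delta_ge0 s0).
exact: V_sub_le_Delta.
Qed.

(** At a state of maximal error, the pi-average of the advantages of [pistar] is the error minus its
    discounted average, hence at least (1 - gamma) [subopt pi]. *)
Lemma exists_bad_action pi : is_policy pi -> 0 < subopt pi ->
  exists s a, 0 < pi s a /\
    (1 - gamma) * subopt pi <= Q pistar s a - V pistar s.
Proof.
move=> hpi M0.
(* Positivity rules out the seed 0, so the maximum is attained at a state. *)
have [s Ms] : exists s, subopt pi <= V pi s - V pistar s.
  apply: contrapT => none.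
  suff : subopt pi < subopt pi by rewrite ltxx.
  apply: bigmax_lt => // s _; rewrite ltNge; apply/negP => Ms.
  by apply: none; exists s.
have [a [pia advle]] :=
  exists_ge_avg (fun a => Q pistar s a - V pistar s) (hpi s).
exists s, a; split=> //; apply: le_trans advle.
rewrite -psi_avg//; have := V_sub c hP hg0 hg1 s hpistar hpi.
have := trans_pi_le hP s hpi (le_subopt pi).
move=> /(ler_wpM2l hg0); lra.
Qed.

(** * Progress of a single step *)

Section Step.
Variables (eta : R) (pi rho : S -> A -> R).
Hypotheses (hpi : is_policy pi) (hrho : is_policy rho).
Hypothesis rho_min : forall s p, in_simplex p ->
  obj eta pi s (rho s) <= obj eta pi s p.

Let rho_psi s p : in_simplex p ->
  eta * psi pi s (rho s) + 2^-1 * \sum_a (rho s a - pi s a) ^+ 2 <=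
  eta * psi pi s p + 2^-1 * \sum_a (p a - pi s a) ^+ 2.
Proof. by move=> /(rho_min s); rewrite /pmd_obj /Defs.psi; lra. Qed.

Let dist_ge0 s : 0 <= 2^-1 * \sum_a (rho s a - pi s a) ^+ 2.
Proof. by rewrite mulr_ge0// ?invr_ge0// sumr_ge0// => a _; exact: sqr_ge0. Qed.

Let eta_psi_le0 s :
  eta * psi pi s (rho s) + 2^-1 * \sum_a (rho s a - pi s a) ^+ 2 <= 0.
Proof.
apply: le_trans (rho_psi s (hpi s)) _; rewrite psi_self// mulr0 add0r.
by rewrite big1 ?mulr0// => a _; rewrite subrr expr0n.
Qed.

(** The case eta = 0 does arise: when [Delta] is 0, division by zero makes the step size 0. Then
    only the distance is minimized and rho = pi. *)
Lemma pmd_step_psi_le0 s : 0 <= eta -> psi pi s (rho s) <= 0.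
Proof.
rewrite le_eqVlt => /orP[/eqP eta0|eta_gt0].
  have := eta_psi_le0 s; rewrite -eta0 mul0r add0r pmulr_rle0// => sum_le0.
  have sum0 : \sum_a (rho s a - pi s a) ^+ 2 = 0.
    by apply/eqP; rewrite eq_le sum_le0 sumr_ge0// => a _; exact: sqr_ge0.
  have rhoE a : rho s a = pi s a.
    have /eqP := psumr_eq0P (fun a _ => sqr_ge0 (rho s a - pi s a)) sum0
      (i := a) isT.
    by rewrite sqrf_eq0 subr_eq0 => /eqP.
  by rewrite (_ : rho s = pi s) ?psi_self//; apply/funext.
rewrite -(pmulr_rle0 _ eta_gt0).
by have := eta_psi_le0 s; have := dist_ge0 s; lra.
Qed.

Lemma pmd_step_V_le s : 0 <= eta -> V rho s <= V pi s.
Proof.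
move=> eta0; rewrite -subr_le0.
have psi0 s' := pmd_step_psi_le0 s' eta0.
exact: le_trans (V_sub_le_psi hP hg0 hg1 hpi hrho psi0 s) (psi0 s).
Qed.

Lemma pmd_step_subopt_le : 0 <= eta -> subopt rho <= subopt pi.
Proof.
move=> eta0; apply: subopt_le => [|s]; first exact: subopt_ge0.
by apply: le_trans (le_subopt pi s); rewrite lerD2r pmd_step_V_le.
Qed.

(** Testing minimality against [pistar] costs at most 1 / eta, since the distance term is at most 1;
    [V_sub] for [pistar] supplies the factor gamma. *)
Lemma pmd_step_contraction : 0 < eta ->
  subopt rho <= gamma * subopt pi + eta^-1.
Proof.
move=> eta0; apply: subopt_le => [|s].
  by rewrite addr_ge0 ?mulr_ge0 ?subopt_ge0// invr_ge0 ltW.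
have psi0 s' := pmd_step_psi_le0 s' (ltW eta0).
have := V_sub_le_psi hP hg0 hg1 hpi hrho psi0 s.
have : psi pi s (rho s) <= psi pi s (pistar s) + eta^-1.
  rewrite -(ler_pM2l eta0) [leRHS]mulrDr divff ?gt_eqF//.
  have := rho_psi s (hpistar s); have := dist_ge0 s.
  have := sqr_dist_simplex_le (hpistar s) (hpi s); lra.
have := V_sub c hP hg0 hg1 s hpi hpistar; rewrite trans_piB.
have := trans_pi_le hP s hpistar (le_subopt pi); rewrite trans_piB.
move=> /(ler_wpM2l hg0); lra.
Qed.

Lemma pmd_step_eq0 s a : 0 <= eta ->
  2 <= eta * (Q pistar s a - V pistar s - subopt pi) -> rho s a = 0.
Proof.
(* An action with Q at most the average V serves as the competitor receiving the mass. *)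
move=> eta0 far; have [a' [_ a'le]] := exists_le_avg (Q pi s) (hpi s).
apply: (pmd_argmin_eq0 (hpi s) (hrho s) (rho_min s) (a' := a')).
apply: le_trans far _; rewrite ler_wpM2l//.
apply: le_trans (adv_le s a hpi) _.
by rewrite lerB// V_avg_Q.
Qed.

End Step.

(** A greedy action has Q^pi <= V^pi, so by hypothesis it is also no worse than average for
    [pistar]; policy improvement over [pistar] concludes. *)
Lemma greedy_optimal pi hpi : is_policy pi -> is_greedy P c gamma pi hpi ->
  (forall s a, Q pi s a <= V pi s -> Q pistar s a <= V pistar s) ->
  is_optimal P c gamma hpi.
Proof.
move=> hpol greedy good.
have hhpi : is_policy hpi.
  move=> s; have [[a0 ha0] _] := greedy s.
  by rewrite (_ : hpi s = fun a => (a == a0)%:R);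
    [exact: simplex_vertex|exact/funext].
have psi0 s : psi pistar s (hpi s) <= 0.
  have [[a0 ha0] hmin] := greedy s.
  have psiV pi' : psi pi' s (hpi s) = Q pi' s a0 - V pi' s.
    by rewrite psiE; under eq_bigr do rewrite ha0; rewrite avg_vertex.
  rewrite psiV subr_le0; apply: good.
  by rewrite -subr_le0 -psiV -(psi_self c hP hg0 hg1 s hpol); exact: hmin.
split=> // rho hrho s; apply: le_trans (Vstar_le s hrho).
rewrite -subr_le0; apply: le_trans (psi0 s).
exact: V_sub_le_psi.
Qed.

End OptimalReference.
End PMDStep.

(** * Numerical bounds on the epoch length *)

Section Constants.
Variables (R : realType) (gamma : R).
Hypotheses (hg0 : 0 <= gamma) (hg1 : gamma < 1).

Local Notation N := (N_const gamma).

Lemma le_natr_absz_ceil (x : R) : x <= (`|Num.ceil x|%N)%:R.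
Proof.
by rewrite natr_absz (le_trans (ceil_ge x))// ler_int ler_norm.
Qed.

Lemma N_const_ge : 4 <= N%:R * (1 - gamma).
Proof. by rewrite -ler_pdivrMr ?subr_gt0//; exact: le_natr_absz_ceil. Qed.

Lemma N_const_ge4 : (4 <= N)%N.
Proof.
rewrite -(ler_nat R); apply: le_trans N_const_ge _.
by rewrite ler_piMr// lerBlDr lerDl.
Qed.

Lemma T_const_ge (S A : finType) : (0 < #|S|)%N -> (1 < #|A|)%N ->
  4 <= 2 ^+ T_const S A gamma * (1 - gamma) ^+ 2.
Proof.
move=> S0 A1; have g2 : 0 < (1 - gamma) ^+ 2 by rewrite exprn_gt0// subr_gt0.
rewrite /T_const; set n := (#|S| ^ 3 * #|A|)%N; set m := absz _.
have n2 : (2 <= n)%N by rewrite -[2%N]mul1n leq_mul// expn_gt0 S0.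
have ln2 : 0 < ln 2 :> R by rewrite ln_gt0// ltr1n.
have x0 : 0 < n%:R / (1 - gamma) ^+ 2 :> R.
  by rewrite divr_gt0// ltr0n (leq_trans _ n2).
(* The logarithm yields n >= 2, as |A| >= 2; the successor in T supplies the other factor 2. *)
suff le_n : n%:R <= 2 ^+ m * (1 - gamma) ^+ 2.
  have le_2 : 2 <= n%:R :> R by rewrite ler_nat.
  have := ler_wpM2l (ler0n R 2) (le_trans le_2 le_n).
  by rewrite mulrA -exprS -natrM.
rewrite -ler_pdivrMr// -[leLHS]lnK ?posrE// -[X in X ^+ m]lnK ?posrE//.
rewrite -expRM_natl ler_expR -ler_pdivrMr//; exact: le_natr_absz_ceil.
Qed.

(* The step-size noise decays like 2^-m; keeping the rate away from 1/2 turns the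
   recursion x_{m+1} = gamma x_m + 2^-(m+1) into a clean geometric bound. *)
Definition rate : R := Order.max gamma (3 / 4).

Lemma rate_ge : 3 / 4 <= rate.
Proof. by rewrite le_max lexx orbT. Qed.

(** The factor 2^n from earlier epochs is discarded, so every epoch obeys the same recursion. *)
Lemma invf_step_size_le n m (D : R) : 0 < D ->
  (2 ^+ (n + m).+1 / D)^-1 <= (2 ^+ m)^-1 / 2 * D.
Proof.
move=> D0; rewrite invf_div mulrC ler_pM2r// -invfM -exprSr.
by rewrite lef_pV2 ?posrE ?exprn_gt0// ler_weXn2l ?ler1n// ltnS leq_addl.
Qed.

(** The term -2 / 2^m absorbs the noise: the induction closes because 1/2 - 2 rate <= -1, that is,
    rate >= 3/4. *)
Lemma recursion_le m (D x x' e : R) : 0 < D -> 0 <= x ->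
  x <= (3 * rate ^+ m - 2 * (2 ^+ m)^-1) * D ->
  e <= (2 ^+ m)^-1 / 2 * D -> x' <= gamma * x + e ->
  x' <= (3 * rate ^+ m.+1 - 2 * (2 ^+ m.+1)^-1) * D.
Proof.
move=> D0 x0 xle ele /le_trans; apply.
have gle : gamma <= rate by rewrite /rate le_max lexx.
apply: le_trans (lerD (ler_pM hg0 x0 gle xle) ele) _.
rewrite mulrA -mulrDl ler_pM2r// exprS [2 ^+ m.+1]exprS invfM.
have : 0 < (2 ^+ m)^-1 :> R by rewrite invr_gt0 exprn_gt0.
move: (rate ^+ m) (2 ^+ m)^-1 rate_ge => y z; nra.
Qed.

(** Here gamma^N <= exp(-N (1 - gamma)) <= exp(-4), and e >= 2. *)
Lemma exprn_N_const_le : gamma ^+ N <= 1 / 16.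
Proof.
have gexp : gamma <= expR (- (1 - gamma)).
  by apply: le_trans (expR_ge1Dx _); lra.
apply: le_trans (lerXn2r N _ _ gexp) _; rewrite ?nnegrE ?expR_ge0//.
rewrite -expRM_natl; apply: le_trans (_ : expR (- 4) <= _).
  by rewrite ler_expR mulrN lerN2 N_const_ge.
rewrite expRN -[X in expR X]mulr1 expRM_natl div1r lef_pV2 ?posrE//.
have e2 : 2 <= expR 1 :> R by apply: le_trans (expR_ge1Dx _); lra.
rewrite (_ : 16 = 2 ^+ 4); last by ring.
by rewrite lerXn2r// nnegrE// expR_ge0.
Qed.

Lemma rate_exprn_N_const_le : rate ^+ N <= 8 / 25.
Proof.
have [->|->] : rate = gamma \/ rate = 3 / 4.
- by rewrite /rate; case: leP; [right|left].
- by apply: le_trans exprn_N_const_le _; lra.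
have : (3 / 4 : R) ^+ N <= (3 / 4) ^+ 4.
  by rewrite ler_wiXn2l ?N_const_ge4//; lra.
by rewrite !exprS expr0; lra.
Qed.

(** From (2 rate^N)^T <= (16/25)^2 and 2^T >= 4 / (1 - gamma)^2 one bounds rate^(NT); lowering the
    exponent by one costs a factor 4/3. *)
Lemma rate_exprn_le (S A : finType) : (0 < #|S|)%N -> (1 < #|A|)%N ->
  3 * rate ^+ (N * T_const S A gamma).-1 <= (1 - gamma) ^+ 2 / 2.
Proof.
move=> S0 A1; move: (T_const _ _ _) (T_const_ge S0 A1) => T T4.
have T2 : (2 <= T)%N.
  rewrite ltnNge; apply/negP => T1; have : 2 ^+ T * (1 - gamma) ^+ 2 <= 2 * 1.
    apply: ler_pM; rewrite ?sqr_ge0 ?exprn_ge0//.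
      by rewrite -[leRHS]expr1 ler_weXn2l// ler1n.
    by rewrite exprn_ile1 ?gerBl// subr_ge0 ltW.
  by move=> /(le_trans T4); rewrite mulr1 ler_nat.
have r0 : 0 <= rate by apply: le_trans rate_ge; lra.
have NT : (0 < N * T)%N by rewrite muln_gt0 (ltnW T2) (leq_trans _ N_const_ge4).
have rT : (2 * rate ^+ N) ^+ T <= (16 / 25) ^+ 2.
  apply: (@le_trans _ _ ((16 / 25) ^+ T)).
    rewrite lerXn2r ?nnegrE ?mulr_ge0 ?exprn_ge0//.
    by have := rate_exprn_N_const_le; lra.
  by rewrite ler_wiXn2l//; lra.
have : 3 / 4 * rate ^+ (N * T).-1 <= rate ^+ (N * T).
  by rewrite -[in leRHS](prednK NT) exprS ler_wpM2r ?exprn_ge0// rate_ge.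
have x0 : 0 <= rate ^+ (N * T) by rewrite exprn_ge0.
have := sqr_ge0 (1 - gamma).
have := ler_wpM2r (sqr_ge0 (1 - gamma)) rT; have := ler_wpM2l x0 T4.
rewrite exprMn -exprM (_ : (16 / 25) ^+ 2 = 256 / 625); last by field.
clear; move: (2 ^+ T) (rate ^+ (N * T)) (rate ^+ _) (_ ^+ 2) => p x y w.
lra.
Qed.

End Constants.

(** * Epochs and elimination of actions *)

Section PMDRun.
Variables (R : realType) (S A : finType).
Variables (P : S -> A -> S -> R) (c : S -> A -> R) (gamma : R).
Hypothesis hP : is_transition P.
Hypotheses (hg0 : 0 <= gamma) (hg1 : gamma < 1).
Variable pis : nat -> S -> A -> R.
Hypothesis hrun : is_pmd_run P c gamma pis.
Hypotheses (S0 : (0 < #|S|)%N) (A1 : (1 < #|A|)%N).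
Variable pistar : S -> A -> R.
Hypothesis hpistar : is_policy pistar.

Local Notation V := (Vpi P c gamma).
Local Notation Q := (Qpi P c gamma).
Local Notation Delta := (Delta P c gamma).
Local Notation adv := (fun s a => Q pistar s a - V pistar s).
Local Notation M t := (subopt P c gamma pistar (pis t)).
Local Notation eta := (eta_step P c gamma pis).

Hypothesis adv_ge0 : forall s a, 0 <= adv s a.

Variable L : nat.
Hypothesis LE : L = (N_const gamma * T_const S A gamma)%N.

Lemma pmd_policy t : is_policy (pis t).
Proof. by case: t => [|t] s; [exact: hrun.1|exact: (hrun.2 t s).1]. Qed.

Lemma epoch_gt0 : (0 < L)%N.
Proof. by rewrite LE muln_gt0 (leq_trans _ (N_const_ge4 hg0 hg1)). Qed.

Lemma epoch_rate_le : 3 * rate gamma ^+ L.-1 <= (1 - gamma) ^+ 2 / 2.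
Proof. by rewrite LE; exact: rate_exprn_le. Qed.

Lemma epoch_exprn_ge : 4 <= 2 ^+ L * (1 - gamma) ^+ 2.
Proof.
apply: le_trans (T_const_ge hg1 S0 A1) _.
rewrite ler_wpM2r ?sqr_ge0// ler_weXn2l ?ler1n// LE leq_pmull//.
by rewrite (leq_trans _ (N_const_ge4 hg0 hg1)).
Qed.

Lemma etaE t : eta t = 2 ^+ t.+1 / Delta (pis (t %/ L * L)).
Proof. by rewrite /eta_step -LE. Qed.

Lemma pmd_Delta_ge0 t : 0 <= Delta (pis t).
Proof.
have [s0 _] := card_gt0P S0.
exact (Delta_ge0 hP hg0 hg1 hpistar adv_ge0 s0 (pmd_policy t)).
Qed.

Lemma pmd_subopt_le_Delta t : M t <= Delta (pis t).
Proof.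
have [s0 _] := card_gt0P S0.
exact (subopt_le_Delta hP hg0 hg1 hpistar adv_ge0 s0 (pmd_policy t)).
Qed.

Lemma pmd_Delta_le t : (1 - gamma) * Delta (pis t) <= M t.
Proof.
have [s0 _] := card_gt0P S0.
exact (Delta_le hP hg0 hg1 hpistar adv_ge0 s0 (pmd_policy t)).
Qed.

Lemma eta_ge0 t : 0 <= eta t.
Proof. by rewrite divr_ge0 ?exprn_ge0// pmd_Delta_ge0. Qed.

Lemma pmd_subopt_anti t t' : (t <= t')%N -> M t' <= M t.
Proof.
move=> tt'; rewrite -(subnKC tt'); elim: (t' - t)%N => [|m IHm].
  by rewrite addn0.
rewrite addnS; apply: le_trans IHm.
exact (pmd_step_subopt_le hP hg0 hg1 pistar (pmd_policy _) (pmd_policy _)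
  (fun s => (hrun.2 (t + m)%N s).2) (eta_ge0 _)).
Qed.

Lemma pmd_subopt_epoch k m : (m <= L)%N -> 0 < Delta (pis (k * L)) ->
  M (k * L + m) <=
  (3 * rate gamma ^+ m - 2 * (2 ^+ m)^-1) * Delta (pis (k * L)).
Proof.
move=> + D0; elim: m => [_|m IHm mL].
  rewrite addn0 !expr0 invr1 (_ : _ - _ = 1); last by ring.
  by rewrite mul1r pmd_subopt_le_Delta.
(* Throughout an epoch the step sizes refer to the same [Delta], that of its first policy. *)
have eta_km : eta (k * L + m) = 2 ^+ (k * L + m).+1 / Delta (pis (k * L)).
  by rewrite etaE divnMDl ?divn_small ?addn0 ?epoch_gt0.
have eta0 : 0 < eta (k * L + m) by rewrite eta_km divr_gt0// exprn_gt0.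
rewrite addnS.
apply: (recursion_le (e := (eta (k * L + m))^-1) hg0 D0 _ (IHm (ltnW mL))).
- exact: subopt_ge0.
- by rewrite eta_km; exact: invf_step_size_le.
- exact (pmd_step_contraction hP hg0 hg1 hpistar (pmd_policy _)
    (pmd_policy _) (fun s => (hrun.2 (k * L + m)%N s).2) eta0).
Qed.

(** The earliest admissible t is the last index kL + L - 1 of epoch k, from which the first policy
    of the next epoch is computed. *)
Lemma pmd_subopt_small k t : (k.+1 * L <= t.+1)%N ->
  M t <= (1 - gamma) / 2 * M (k * L).
Proof.
move=> kt; have [M0|Mk0] := leP (M (k * L)) 0.
  have Mk : M (k * L) = 0 by apply/eqP; rewrite eq_le M0 subopt_ge0.
  rewrite Mk mulr0 -Mk; apply: pmd_subopt_anti; have := epoch_gt0.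
  by move: kt; rewrite mulSn; lia.
have D0 := lt_le_trans Mk0 (pmd_subopt_le_Delta _).
apply: (@le_trans _ _ (M (k * L + L.-1))).
  apply: pmd_subopt_anti; have := epoch_gt0.
  by move: kt; rewrite mulSn; lia.
apply: le_trans (pmd_subopt_epoch (leq_pred _) D0) _.
have := pmd_Delta_le (k * L); have := epoch_rate_le.
have : 0 < (2 ^+ L.-1)^-1 :> R by rewrite invr_gt0 exprn_gt0.
set r := rate gamma ^+ _; set y := (_ ^+ _)^-1; set D := Delta _ => y0 rle Dle.
clearbody r y.
apply: (@le_trans _ _ ((1 - gamma) ^+ 2 / 2 * D)).
  by rewrite ler_pM2r//; lra.
have g1 : 0 <= (1 - gamma) / 2 by rewrite divr_ge0// subr_ge0 ltW.
by have := ler_wpM2l g1 Dle; lra.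
Qed.

(** With j the start of the epoch of t, adv - M_t >= (1 - gamma) M_k / 2 >= (1 - gamma)^2 Delta_j /
    2, where M_k is the error at kL. Since 2^(t+1) (1 - gamma)^2 >= 4, multiplying by eta_t gives at
    least 2. Positivity of M_t ensures Delta_j > 0. *)
Lemma pmd_eliminated k t s a : (1 - gamma) * M (k * L) <= adv s a ->
  (k.+1 * L <= t.+1)%N -> 0 < M t -> pis t.+1 s a = 0.
Proof.
move=> bad kt Mt0.
have kj : (k <= t %/ L)%N.
  rewrite leq_divRL ?epoch_gt0//; have := epoch_gt0.
  by move: kt; rewrite mulSn; lia.
have Mj0 : 0 < M (t %/ L * L).
  by apply: lt_le_trans Mt0 _; apply: pmd_subopt_anti; exact: leq_divM.
have D0 := lt_le_trans Mj0 (pmd_subopt_le_Delta _).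
apply: (pmd_step_eq0 hP hg0 hg1 hpistar adv_ge0 (pmd_policy t) (pmd_policy _)
  (fun s => (hrun.2 t s).2) (eta_ge0 t)).
have Mkj : M (t %/ L * L) <= M (k * L).
  by apply: pmd_subopt_anti; rewrite leq_mul2r kj orbT.
have Dj := pmd_Delta_le (t %/ L * L).
have Mt := pmd_subopt_small kt.
have pow : 4 <= 2 ^+ t.+1 * (1 - gamma) ^+ 2.
  apply: le_trans epoch_exprn_ge _.
  rewrite ler_wpM2r ?sqr_ge0// ler_weXn2l ?ler1n//.
  by apply: leq_trans kt; rewrite mulSn leq_addr.
rewrite etaE mulrAC ler_pdivlMr//.
set D := Delta _ in Dj D0 *; set x := adv s a - _.
have xD : (1 - gamma) ^+ 2 / 2 * D <= x.
  have : (1 - gamma) / 2 * ((1 - gamma) * D) <= (1 - gamma) / 2 * M (k * L).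
    by apply: ler_wpM2l (le_trans Dj Mkj); rewrite divr_ge0// subr_ge0 ltW.
  by rewrite /x; move: bad Mt; lra.
apply: le_trans (_ : 2 ^+ t.+1 * ((1 - gamma) ^+ 2 / 2 * D) <= _).
  by have := ler_wpM2r (ltW D0) pow; move: (2 ^+ _) {pow} => p; lra.
by rewrite ler_wpM2l// exprn_ge0.
Qed.

(* The bad actions found at the starts of the first |S|(|A|-1) epochs, one
   optimal action per state, and a would be |S||A|+1 distinct pairs. *)
Lemma pmd_greedy_action tau s a :
  (#|S| * (#|A| - 1) * L <= tau)%N ->
  Q (pis tau) s a <= V (pis tau) s -> Q pistar s a <= V pistar s.
Proof.
move=> htau greedy; rewrite leNgt; apply/negP => bad.
set K := (#|S| * _)%N in htau.
have Mtau0 : adv s a <= M tau.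
  have := adv_le hP hg0 hg1 hpistar adv_ge0 s a (pmd_policy tau); lra.
have Mt0 t : (t <= tau)%N -> 0 < M t.
  move=> /pmd_subopt_anti; apply: lt_le_trans; apply: lt_le_trans Mtau0.
  by rewrite subr_gt0.
have kL (k : 'I_K) : (k.+1 * L <= tau)%N.
  by apply: leq_trans htau; rewrite leq_mul2r ltn_ord orbT.
have /choice[h hbad] : forall k : 'I_K, exists sa : S * A,
    0 < pis (k * L)%N sa.1 sa.2 /\ (1 - gamma) * M (k * L) <= adv sa.1 sa.2.
  move=> k; have Mk0 : 0 < M (k * L).
    by apply: Mt0; apply: leq_trans (kL k); rewrite leq_mul2r leqnSn orbT.
  have [s1 [a1 sa1]] := exists_bad_action hP hg0 hg1 hpistar (pmd_policy _) Mk0.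
  by exists (s1, a1).
have h_bad k : 0 < adv (h k).1 (h k).2.
  apply: lt_le_trans (hbad k).2; rewrite mulr_gt0 ?subr_gt0//.
  by apply: Mt0; apply: leq_trans (kL k); rewrite leq_mul2r leqnSn orbT.
(* The pair found in epoch k has mass 0 at the start of epoch k', where the pair found has positive
   mass. *)
have h_lt (k k' : 'I_K) : (k < k')%N -> h k <> h k'.
  move=> kk' hkk'; have := (hbad k').1; rewrite -hkk'.
  have kk'L : (k.+1 * L <= k' * L)%N by rewrite leq_mul2r kk' orbT.
  have k'L0 : (0 < k' * L)%N.
    by rewrite muln_gt0 epoch_gt0 (leq_ltn_trans _ kk').
  rewrite -(prednK k'L0) (pmd_eliminated (hbad k).2) ?ltxx// ?prednK//.
  apply: Mt0; apply: leq_trans (leq_pred _) _.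
  by apply: leq_trans (kL k'); rewrite leq_mul2r leqnSn orbT.
have h_inj : injective h.
  move=> k k' hkk'; apply/val_inj.
  have [/h_lt/(_ hkk')|/h_lt/(_ (esym hkk'))|] := ltngtP k k'; last by [].
  - by [].
  - by [].
(* Otherwise adv s a <= M tau <= (1 - gamma) M_k / 2 <= adv s a / 2, contradicting adv s a > 0. *)
have h_neq k : h k <> (s, a).
  move=> hk; have := (hbad k).2; have := h_bad k; rewrite hk/=.
  have := pmd_subopt_small (leq_trans (kL k) (leqnSn _)).
  by move: Mtau0; lra.
have /choice[f fopt] : forall s, exists a, adv s a <= 0.
  move=> s1; have [a1 [_ le1]] := exists_le_avg (Q pistar s1) (hpistar s1).
  by exists a1; rewrite subr_le0 (V_avg_Q c hP hg0 hg1 _ hpistar).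
pose g (x : option ('I_K + S)) : S * A :=
  match x with
  | None => (s, a) | Some (inl k) => h k | Some (inr s1) => (s1, f s1)
  end.
have fNbad s1 x : 0 < adv x.1 x.2 -> x <> (s1, f s1).
  by move=> + xE; rewrite xE/= ltNge fopt.
have bad' : 0 < adv s a by rewrite subr_gt0.
have g_inj : injective g.
  move=> [[k|s1]|] [[k'|s2]|] //=.
  - by move=> /h_inj ->.
  - by move=> /(fNbad _ _ (h_bad k)).
  - by move=> /h_neq.
  - by move=> /esym/(fNbad _ _ (h_bad k')).
  - by case=> ->.
  - by move=> /esym/(fNbad s1 (s, a) bad').
  - by move=> /esym/h_neq.
  - by move=> /(fNbad s2 (s, a) bad').
have := leq_card g g_inj.
rewrite card_option card_sum card_ord card_prod /K mulnBr muln1.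
have : (#|S| <= #|S| * #|A|)%N by rewrite leq_pmulr// (leq_trans _ A1).
lia.
Qed.

End PMDRun.

Theorem theorem3p10 (R : realType) (S A : finType)
  (P : S -> A -> S -> R) (c : S -> A -> R) (gamma : R)
  (hP : is_transition P) (hg0 : 0 <= gamma) (hg1 : gamma < 1)
  (pis : nat -> S -> A -> R) (hrun : is_pmd_run P c gamma pis)
  (tau : nat)
  (htau : (#|S| * (#|A| - 1) * N_const gamma * T_const S A gamma <= tau)%N)
  (hpi : S -> A -> R) (hgreedy : is_greedy P c gamma (pis tau) hpi) :
  is_optimal P c gamma hpi.
Proof.
have [pistar hpistar adv_ge0] := exists_adv_ge0 c hP hg0 hg1 hrun.1.
apply: (greedy_optimal hP hg0 hg1 hpistar adv_ge0 (pmd_policy hrun tau)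
  hgreedy) => s a greedy.
have S0 : (0 < #|S|)%N by apply/card_gt0P; exists s.
rewrite leNgt; apply/negP => bad.
(* Some action is no worse than average for [pistar] and hence differs from the bad one. *)
have A1 : (1 < #|A|)%N.
  have [a' [_ a'le]] := exists_le_avg (Qpi P c gamma pistar s) (hpistar s).
  have aa' : a != a'.
    apply: contraTneq bad => ->.
    by rewrite -leNgt (V_avg_Q c hP hg0 hg1 _ hpistar).
  by apply/card_gt1P; exists a, a'.
move: bad; rewrite ltNge => /negP; apply; move: htau; rewrite -mulnA => htau'.
exact: (pmd_greedy_action hP hg0 hg1 hrun S0 A1 hpistar adv_ge0 erefl htau'
  greedy).
Qed.
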